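(* Consider TD-PQA with any constant step size $\eta>0$ and any initialization $V^0\in\mathbb{R}^{|\mathcal{S}|}$, $\pi_0$. Let $\pi^*$ be a deterministic optimal policy, let $$\varepsilon=\frac{\eta\gamma\Delta^2}{2\eta\gamma\Delta+2},\qquad \kappa_0=\max\Big\{0,\frac{1}{1-\gamma}\max_{s}[V^0-\mathcal{T}^{\pi_0}V^0](s)\Big\},$$ $$B=\frac{2\gamma}{\varepsilon}\left(\frac{1}{(1-\gamma)^2}+\frac{\|V^0\|_\infty+\kappa_0}{1-\gamma}+\frac{\|D^{\pi^*}_{\pi_0}\|_\infty}{\eta(1-\gamma)}\right),$$ and $$T_0=\begin{cases}\left\lceil\max\left\{B,\ \dfrac{\log\varepsilon-\log(2\gamma)-\log\kappa_0}{\log\gamma}\right\}\right\rceil,&\text{if }\kappa_0>0,\\[1em] \lceil B\rceil,&\text{if }\kappa_0=0.\end{cases}$$ Then for all $k\ge T_0$ the policy $\pi_k$ is optimal, i.e. $Q^{\pi_k}=Q^*$ and $V^{\pi_k}=V^*$.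
   Context: MDP: $\mathcal{S},\mathcal{A}$ are finite nonempty sets (states, actions), $P(\cdot|s,a)$ is a transition kernel, $r:\mathcal{S}\times\mathcal{A}\to[0,1]$ is the reward, $\gamma\in(0,1)$. $\Delta(\mathcal{A})$ is the probability simplex on $\mathcal{A}$. A policy $\pi$ assigns $\pi(\cdot|s)\in\Delta(\mathcal{A})$ to each $s$. $V^\pi(s)=\mathbb{E}[\sum_{t\ge0}\gamma^t r(s_t,a_t)\mid s_0=s,\pi]$ with $a_t\sim\pi(\cdot|s_t)$, $s_{t+1}\sim P(\cdot|s_t,a_t)$; $Q^\pi(s,a)=r(s,a)+\gamma\mathbb{E}_{s'\sim P(\cdot|s,a)}[V^\pi(s')]$; $V^*=\max_\pi V^\pi$ and $Q^*=\max_\pi Q^\pi$ (componentwise); $\pi$ is optimal if $V^\pi=V^*$. The Bellman operator is $\mathcal{T}^\pi V(s)=\mathbb{E}_{a\sim\pi(\cdot|s),s'\sim P(\cdot|s,a)}[r(s,a)+\gamma V(s')]$. $\|\cdot\|_\infty$ is the max norm. Optimal action sets: $\mathcal{A}^*_s=\arg\max_{a}Q^*(s,a)$, $\tilde{\mathcal{S}}=\{s:\mathcal{A}^*_s\ne\mathcal{A}\}$, assumed nonempty. The optimal action value gap is $\Delta=\min_{s\in\tilde{\mathcal{S}},\,a'\notin\mathcal{A}^*_s}[\max_{a}Q^*(s,a)-Q^*(s,a')]$. TD-PQA with constant step size $\eta>0$ (TD-PMD with mirror map $h(p)=\frac12\|p\|_2^2$): given any $V^0\in\mathbb{R}^{|\mathcal{S}|}$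 and any policy $\pi_0$, for $k=0,1,2,\dots$ set $Q^k(s,a)=r(s,a)+\gamma\mathbb{E}_{s'\sim P(\cdot|s,a)}[V^k(s')]$; $\pi_{k+1}(\cdot|s)=\mathrm{Proj}_{\Delta(\mathcal{A})}(\pi_k(\cdot|s)+\eta Q^k(s,\cdot))$ (Euclidean projection) for every $s$; $V^{k+1}=\mathcal{T}^{\pi_{k+1}}V^k$. Here $\|D^{\pi^*}_{\pi_0}\|_\infty=\max_s\frac12\|\pi^*(\cdot|s)-\pi_0(\cdot|s)\|_2^2$. *)

(* Defs.v *)
From HB Require Import structures.
From mathcomp Require Import all_boot all_order all_algebra.
From mathcomp Require Import all_classical all_reals all_analysis.
From mathcomp Require Import measurable_realfun lra.

Set Implicit Arguments.
Unset Strict Implicit.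
Unset Printing Implicit Defensive.

Import Order.TTheory GRing.Theory Num.Theory.
Import numFieldNormedType.Exports.

Local Open Scope classical_set_scope.
Local Open Scope ring_scope.

Section finite_functions.
Context {R : realType} {T : finType}.
Implicit Types f x p : T -> R.

Definition simplex : set (T -> R) :=
  [set p | (forall t, 0 <= p t) /\ \sum_t p t = 1].

(* On a nonempty finite type this supremum is attained. *)
Definition fmax f : R := sup (range f).

Definition maxnorm f : R := fmax (fun t => `|f t|).

Definition l2norm f : R := Num.sqrt (\sum_t f t ^+ 2).

Definition is_eproj (C : set (T -> R)) x p : Prop :=
  C p /\ forall y, C y -> l2norm (x \- p) <= l2norm (x \- y).

End finite_functions.

Record mdp (R : realType) (S A : finType) := MDP {
  trans : S -> A -> S -> R;
  reward : S -> A -> R;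
  discount : R;
  states_ne : (0 < #|S|)%N;
  actions_ne : (0 < #|A|)%N;
  trans_simplex : forall s a, simplex (trans s a);
  reward_itv : forall s a, 0 <= reward s a <= 1;
  discount_itv : 0 < discount < 1
}.

Record policy (R : realType) (S A : finType) := Policy {
  prob_of :> S -> A -> R;
  policy_simplex : forall s, simplex (prob_of s)
}.

(* Existence of the law of a process with prescribed conditional laws: the    *)
(* process is simulated from a uniform variable w on [0, 1] by inverting      *)
(* distribution functions. Histories h are listed most recent item first,     *)
(* and q h is the law of the next item.                                       *)
Section sampling.
Context {R : realType} {X : finType} (x0 : X) (q : seq X -> X -> R).
Hypothesis q_ge0 : forall h x, 0 <= q h x.
Hypothesis q_sum1 : forall h, \sum_x q h x = 1.

Let cum (h : seq X) (x : X) : R :=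
  \sum_(y <- take (index x (enum X)) (enum X)) q h y.

Fixpoint samp_len (h : seq X) : R :=
  if h is x :: h' then samp_len h' * q h' x else 1.

Fixpoint samp_lo (h : seq X) : R :=
  if h is x :: h' then samp_lo h' + samp_len h' * cum h' x else 0.

Definition samp_itv (h : seq X) : interval R :=
  `[samp_lo h, samp_lo h + samp_len h[.

Fixpoint samp_hist (w : R) (n : nat) : seq X :=
  if n is n'.+1 then
    odflt x0 [pick x | w \in samp_itv (x :: samp_hist w n')] :: samp_hist w n'
  else [::].

Definition samp_path (w : R) (n : nat) : X := head x0 (samp_hist w n.+1).

Let enumsum1 h : \sum_(y <- enum X) q h y = 1.
Proof. by rewrite -[RHS](q_sum1 h) big_enum. Qed.

Let sum_ge0 h (e : seq X) : 0 <= \sum_(y <- e) q h y.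
Proof. exact: sumr_ge0. Qed.

Let cum_ge0 h x : 0 <= cum h x. Proof. exact: sum_ge0. Qed.

Lemma samp_len_ge0 h : 0 <= samp_len h.
Proof. by elim: h => //= x h ih; rewrite mulr_ge0. Qed.

Let cumD h x j : (index x (enum X) < j)%N ->
  cum h x + q h x <= \sum_(y <- take j (enum X)) q h y.
Proof.
move=> xj; have xe : (index x (enum X) < size (enum X))%N.
  by rewrite index_mem mem_enum.
have -> : cum h x + q h x =
    \sum_(y <- take (index x (enum X)).+1 (enum X)) q h y.
  rewrite (take_nth x xe) nth_index ?mem_enum// big_rcons /=. by rewrite addrC.
rewrite -(subnKC xj) takeD big_cat/= lerDl; exact: sum_ge0.
Qed.

Let cum_le1 h x : cum h x + q h x <= 1.
Proof.
have: (index x (enum X) < size (enum X))%N by rewrite index_mem mem_enum.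
by move=> /(cumD h); rewrite take_size enumsum1.
Qed.

Let split_sum (f : X -> R) (e : seq X) (l a w : R) :
  a <= w < a + l * \sum_(y <- e) f y ->
  exists e1 x e2, e = e1 ++ x :: e2 /\
    a + l * (\sum_(y <- e1) f y) <= w < a + l * (\sum_(y <- e1) f y) + l * f x.
Proof.
elim: e a => [|x e ih] a.
  by rewrite big_nil mulr0 addr0 => /andP[aw] /(le_lt_trans aw); rewrite ltxx.
rewrite big_cons mulrDr addrA => /andP[aw wa].
have [wx|xw] := ltP w (a + l * f x).
  by exists [::], x, e; split => //; rewrite big_nil mulr0 addr0 aw.
have [|e1 [y [e2 [-> h]]]] := ih (a + l * f x); first by rewrite xw.
exists (x :: e1), y, e2; split => //.
by rewrite big_cons mulrDr addrA.
Qed.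

Let itv_child h w : w \in samp_itv h -> exists x, w \in samp_itv (x :: h).
Proof.
rewrite in_itv/= => hw.
have [|e1 [x [e2 [ee e12]]]] :=
    @split_sum (q h) (enum X) (samp_len h) (samp_lo h) w.
  by rewrite enumsum1 mulr1.
exists x; rewrite in_itv/=; have xe1 : x \notin e1.
  have := enum_uniq X; rewrite ee cat_uniq => /and3P[_ + _].
  by rewrite /= negb_or => /andP[].
rewrite /cum ee index_cat (negbTE xe1)/= eqxx addn0 take_size_cat//.
Qed.

Let itv_parent h x w : w \in samp_itv (x :: h) -> w \in samp_itv h.
Proof.
rewrite !in_itv/= => /andP[h1 h2].
have := samp_len_ge0 h; have := cum_ge0 h x; have := cum_le1 h x.
nra.
Qed.

Let itv_lt h x y w : (index x (enum X) < index y (enum X))%N ->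
  w \in samp_itv (x :: h) -> w \in samp_itv (y :: h) -> False.
Proof.
move=> /(cumD h); rewrite -/(cum h y) => xy.
rewrite !in_itv/= => /andP[h1 h2] /andP[h3 h4].
have := samp_len_ge0 h; nra.
Qed.

Let itv_inj h x y w :
  w \in samp_itv (x :: h) -> w \in samp_itv (y :: h) -> x = y.
Proof.
move=> hx hy.
case: (ltngtP (index x (enum X)) (index y (enum X))) => [xy|yx|].
- by have := itv_lt xy hx hy.
- by have := itv_lt yx hy hx.
- move=> e; rewrite -[LHS](@nth_index _ x0 x (enum X)) ?mem_enum// e.
  by rewrite nth_index ?mem_enum.
Qed.

Let mem_hist w n : w \in samp_itv [::] -> w \in samp_itv (samp_hist w n).
Proof.
move=> w0; elim: n => [|n ih]//.
rewrite [samp_hist w n.+1]/=; case: pickP => [//|] noX.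
by have [x] := itv_child ih; rewrite noX.
Qed.

Let histE w h : w \in samp_itv h -> samp_hist w (size h) = h.
Proof.
elim: h => [//|x h ih] wxh; have wh := itv_parent wxh.
rewrite /= ih//; case: pickP => [y wyh|/(_ x)]; last by rewrite wxh.
by rewrite (itv_inj wyh wxh).
Qed.

Let rev_hist w n : mkseq (samp_path w) n = rev (samp_hist w n).
Proof.
by elim: n => [//|n ih]; rewrite mkseqS ih [RHS]rev_cons.
Qed.

Lemma samp_pathE w h : w \in samp_itv [::] ->
  (mkseq (samp_path w) (size h) = h) <-> (w \in samp_itv (rev h)).
Proof.
move=> w0; rewrite rev_hist; split=> [<-|hw]; first by rewrite revK mem_hist.
by rewrite -(size_rev h) histE// revK.
Qed.

Lemma samp_itv_sub h w : w \in samp_itv h -> w \in samp_itv [::].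
Proof. by elim: h => // x h ih /itv_parent. Qed.

Lemma sampling d (Om : measurableType d) (Z : Om -> nat -> X)
    (p : (nat -> X) -> Om) (G : set (set Om)) :
  cancel p Z -> @measurable _ Om = <<s G >> ->
  G = [set [set w | mkseq (Z w) (size h) = h] | h in [set: seq X]] ->
  exists P : probability Om R, forall h,
    P [set w | mkseq (Z w) (size h) = h] = (samp_len (rev h))%:E.
Proof.
move=> pK mG GE.
pose T := measurableTypeR R.
pose cl (w : T) : R := if (w \in samp_itv [::]) then w else 0.
have cl0 w : cl w \in samp_itv [::].
  by rewrite /cl; case: ifPn => // _; rewrite in_itv/= lexx add0r ltr01.
pose F (w : T) : Om := p (samp_path (cl w)).
have preE h : F @^-1` [set w | mkseq (Z w) (size h) = h] =
    [set w | cl w \in samp_itv (rev h)].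
  apply/seteqP; split => w /=; rewrite /F pK; first by move/samp_pathE; exact.
  by move=> /samp_pathE; apply.
have mpre h : measurable [set w : T | cl w \in samp_itv (rev h)].
  rewrite (_ : [set _ | _] = [set` samp_itv (rev h)] `|`
      (~` [set` samp_itv [::]] `&` [set w | (0 : R) \in samp_itv (rev h)])).
    apply: measurableU; first exact: measurable_itv.
    apply: measurableI; first by apply: measurableC; exact: measurable_itv.
    have [b|b] := boolP ((0 : R) \in samp_itv (rev h)).
      rewrite (_ : mkset _ = setT); first exact: measurableT.
      by apply/seteqP; split.
    rewrite (_ : mkset _ = set0); first exact: measurable0.
    by apply/seteqP; split => // x /=; rewrite (negbTE b).
  apply/seteqP; split => w /=; rewrite /cl.
    by case: ifPn => w0 wh; [left|right; split => //; exact/negP].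
  case=> [wh|[/negP/negbTE -> //]].
  by rewrite (samp_itv_sub wh).
have mF : measurable_fun [set: T] F.
  apply: (measurability G) => //; move=> ? [B0 + <-].
  rewrite GE => -[h _ <-]; rewrite setTI preE; exact: mpre.
pose mFi := isMeasurableFun.Build _ _ T Om F mF.
pose FF : {mfun T >-> Om} := HB.pack F mFi.
exists (distribution (uniform_prob (@ltr01 R)) FF) => h.
rewrite /distribution /pushforward/= preE.
set B := [set w : T | _].
have mB : measurable B := mpre h.
have -> : uniform_prob (@ltr01 R) B = lebesgue_measure (B `&` `[0, 1]).
  have <- : (\int[uniform_prob (@ltr01 R)]_x (\1_B x)%:E =
      uniform_prob (@ltr01 R) B)%E by rewrite integral_indic// setIT.
  rewrite integral_uniform/=; last 2 first.
  - by apply/measurable_EFinP; exact: measurable_indic.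
  - by move=> x; rewrite lee_fin.
  by rewrite subr0 invr1 mul1e integral_indic.
have -> : B `&` `[0, 1] = [set` samp_itv (rev h)] `|` (B `&` [set 1]).
  apply/seteqP; split => w /=.
    move=> [Bw]; rewrite in_itv/= => /andP[w0]; rewrite le_eqVlt => /orP[/eqP w1|w1].
      by right.
    have wI : w \in samp_itv [::] by rewrite /samp_itv in_itv/= w0 add0r.
    by left; move: Bw; rewrite /B/= /cl wI.
  case=> [wh|[Bw w1]]; last first.
    by split=> //; rewrite [w]w1 /= in_itv/= ler01 lexx.
  have := samp_itv_sub wh; move=> w0; split; first by rewrite /B/= /cl w0.
  by move: w0; rewrite !in_itv/= add0r => /andP[-> /ltW].
rewrite measureU0//; last 2 first.
- by apply: measurableI.
- apply/eqP; rewrite -measure_le0 -[leRHS](@lebesgue_measure_set1 R 1).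
  by rewrite le_measure// inE//; exact: measurableI.
have Hl : lebesgue_measure [set` samp_itv (rev h)] = (samp_len (rev h))%:E.
  rewrite lebesgue_measure_itv/= lte_fin ltrDl.
  case: ltP => [_|len_le0]; first by rewrite -EFinB addrAC subrr add0r.
  by congr EFin; apply/eqP; rewrite eq_le len_le0 samp_len_ge0.
exact: Hl.
Qed.

End sampling.

(* Sample paths (s_t, a_t)_t with the sigma-algebra generated by the          *)
(* cylinders. M is a parameter only because a measurableType must be pointed: *)
(* it witnesses that S and A are nonempty.                                    *)
Section trajectories.
Context {R : realType} {S A : finType} (M : mdp R S A).

Definition paths (_ : mdp R S A) : Type := nat -> S * A.

Lemma paths_inhabited : exists x : S * A, true.
Proof.
have /card_gt0P[s _] := states_ne M; have /card_gt0P[a _] := actions_ne M.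
by exists (s, a).
Qed.

Definition default_step : S * A := projT1 (cid paths_inhabited).

HB.instance Definition _ := gen_eqMixin (paths M).
HB.instance Definition _ := gen_choiceMixin (paths M).
HB.instance Definition _ := isPointed.Build (paths M) (fun=> default_step).

Definition cylinder (h : seq (S * A)) : set (paths M) :=
  [set w | mkseq w (size h) = h].

Definition trajectory := g_sigma_algebraType [set cylinder h | h in setT].

(* Probability that a trajectory begins with h, when s_0 has law mu, a_t has  *)
(* law pi(.|s_t) and s_{t+1} has law P(.|s_t, a_t).                           *)
Fixpoint path_prob (pi : policy R S A) (mu : S -> R) (h : seq (S * A)) : R :=
  if h is (s, a) :: h' then mu s * pi s a * path_prob pi (trans M s a) h'
  else 1.

(* This determines Pr, since cylinders (and set0) form a pi-system.           *)
Definition is_trajectory_law (pi : policy R S A) (s : S)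
    (Pr : probability trajectory R) : Prop :=
  forall h, Pr (cylinder h) = (path_prob pi (fun s' => (s' == s)%:R) h)%:E.

Let step (pi : policy R S A) (mu : S -> R) (h : seq (S * A)) (x : S * A) : R :=
  (if h is y :: _ then trans M y.1 y.2 x.1 else mu x.1) * pi x.1 x.2.

Let path_prob_rcons pi mu h x :
  path_prob pi mu (rcons h x) = path_prob pi mu h * step pi mu (rev h) x.
Proof.
elim: h mu => [|[s a] h ih] mu; first by case: x => s a; rewrite /= mulr1 mul1r.
rewrite /= ih rev_cons mulrA; congr (_ * _).
by rewrite /step; case: (rev h).
Qed.

Let step_sum1 pi mu h : simplex mu -> \sum_x step pi mu h x = 1.
Proof.
move=> [_ mu1].
rewrite /step -(pair_bigA _ (fun s a =>
  (if h is y :: _ then trans M y.1 y.2 s else mu s) * pi s a))/=.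
under eq_bigr do rewrite -big_distrr/= (policy_simplex pi _).2 mulr1.
by case: h => [//|y h]; exact: (trans_simplex M _ _).2.
Qed.

Lemma trajectory_law_exists pi s : exists Pr, is_trajectory_law pi s Pr.
Proof.
pose mu s' : R := (s' == s)%:R.
have muP : simplex mu.
  split=> [s'|]; first by rewrite ler0n.
  by rewrite (bigD1 s)//= big1 ?addr0 /mu ?eqxx// => s' /negbTE ->.
have step_ge0 h x : 0 <= step pi mu h x.
  rewrite mulr_ge0 ?(policy_simplex pi _).1//.
  by case: h => [|y h]; [exact: muP.1|exact: (trans_simplex M _ _).1].
have [Pr PrE] := sampling default_step step_ge0
  (fun h => step_sum1 pi h muP) (Om := trajectory) (Z := id)
  (G := [set cylinder h | h in setT]) (fun=> erefl) erefl erefl.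
exists Pr => h; rewrite [LHS]PrE; congr EFin.
elim/last_ind: h => [//|h x ih].
by rewrite rev_rcons/= ih path_prob_rcons.
Qed.

Definition trajectory_law (pi : policy R S A) (s : S) :
  probability trajectory R := projT1 (cid (trajectory_law_exists pi s)).

Definition discounted_return (w : trajectory) : R :=
  limn (series (fun t => discount M ^+ t * reward M (w t).1 (w t).2)).

End trajectories.

Section values.
Context {R : realType} {S A : finType} (M : mdp R S A).
Implicit Types (pi : policy R S A) (V : S -> R).

Definition value pi (s : S) : R :=
  fine ('E_(trajectory_law M pi s)[@discounted_return _ _ _ M])%E.

Definition qbackup V (s : S) (a : A) : R :=
  reward M s a + discount M * \sum_s' trans M s a s' * V s'.

Definition qvalue pi : S -> A -> R := qbackup (value pi).

Definition value_opt (s : S) : R := sup [set value pi s | pi in setT].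

Definition qvalue_opt (s : S) (a : A) : R := sup [set qvalue pi s a | pi in setT].

Definition optimal pi : Prop := value pi = value_opt.

Definition deterministic pi : Prop :=
  forall s, exists a, forall b, pi s b = (b == a)%:R.

Definition bellman pi V (s : S) : R :=
  \sum_a pi s a * \sum_s' trans M s a s' * (reward M s a + discount M * V s').

Definition opt_actions (s : S) : set A :=
  [set a | forall b, qvalue_opt s b <= qvalue_opt s a].

Definition nontrivial_states : set S := [set s | opt_actions s != setT].

Definition action_gap : R :=
  inf [set x | exists s a, [/\ nontrivial_states s, ~ opt_actions s a
                             & x = fmax (qvalue_opt s) - qvalue_opt s a]].

Definition td_pqa (eta : R) (V : nat -> S -> R) (pi : nat -> policy R S A) :=
  forall k s,
    is_eproj simplex (fun a => pi k s a + eta * qbackup (V k) s a) (pi k.+1 s) /\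
    V k.+1 s = bellman (pi k.+1) (V k) s.

Definition bregman_dist pi pi' (s : S) : R := 2^-1 * l2norm (pi s \- pi' s) ^+ 2.

End values.

(* Main.v *)
Require Import Defs.
From mathcomp Require Import all_boot all_order all_algebra.
From mathcomp Require Import all_classical all_reals all_analysis.
From mathcomp Require Import measurable_realfun ring lra.

(* With [Vt k := V k - gamma ^ k * kappa0], the initial [Vt 0] lies below its
   Bellman backup, and this propagates: [Vt] increases and stays below the
   optimal value. The three-point inequality of the projection makes the gap
   [e k := V* - Vt k] satisfy
     e k.+1 + D k.+1 / eta <= gamma P e k + D k / eta,
   where D is the Bregman distance to [pistar]; summing, and using that [e]
   decreases, yields [k * e k.-1 <= C], hence [e k.-1 <= eps / (2 gamma)] as
   soon as [k >= B]. At that stage the mass that the policy [k.-1] puts on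
   suboptimal actions, at most [e k.-1 / Delta], is so small compared with the
   gap [eta (Delta - gamma e k.-1)] between optimal and suboptimal actions that
   the projection cancels it completely.

   The Bellman equation comes from the trajectory laws: the n-step return is
   constant on cylinders of length n, its mean is the n-th Bellman iterate of 0,
   and monotone convergence applies. *)

Set Implicit Arguments.
Unset Strict Implicit.
Unset Printing Implicit Defensive.

Import Order.TTheory GRing.Theory Num.Theory.
Import numFieldNormedType.Exports.

Local Open Scope classical_set_scope.
Local Open Scope ring_scope.

(** * Means under a probability vector, maxima over a finite type *)

Section simplex_mean.
Context {R : realType} {T : finType}.
Implicit Types (p f g : T -> R).

Lemma ler_mean p f g : simplex p -> (forall t, f t <= g t) ->
  \sum_t p t * f t <= \sum_t p t * g t.
Proof. by move=> [p0 _] fg; apply: ler_sum => t _; rewrite ler_wpM2l. Qed.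

Lemma mean_cst p c : simplex p -> \sum_t p t * c = c.
Proof. by move=> [_ p1]; rewrite -mulr_suml p1 mul1r. Qed.

Lemma meanD_cst p f c : simplex p -> \sum_t p t * (f t + c) = \sum_t p t * f t + c.
Proof.
by move=> ps; under eq_bigr do rewrite mulrDr; rewrite big_split/= mean_cst.
Qed.

Lemma mean_le p f c : simplex p -> (forall t, f t <= c) -> \sum_t p t * f t <= c.
Proof. by move=> ps fc; rewrite -[leRHS](mean_cst _ ps); exact: ler_mean. Qed.

Lemma simplex_dirac (t0 : T) : simplex (fun t => (t == t0)%:R : R).
Proof.
split=> [t|]; first by rewrite ler0n.
by rewrite (bigD1 t0)//= big1 ?addr0 ?eqxx// => t /negbTE ->.
Qed.

Lemma mean_dirac f (t0 : T) : \sum_t (t == t0)%:R * f t = f t0.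
Proof.
by rewrite (bigD1 t0)//= eqxx mul1r big1 ?addr0// => t /negbTE ->; rewrite mul0r.
Qed.

Lemma ex_argmax f : (0 < #|T|)%N -> exists t0, forall t, f t <= f t0.
Proof.
move=> /card_gt0P[t _].
by case: (arg_maxP f (erefl : xpredT t)) => t0 _ h; exists t0 => ?; exact: h.
Qed.

Lemma fmax_ub f t : f t <= fmax f.
Proof.
have [|t0 ft0] := ex_argmax f; first by apply/card_gt0P; exists t.
by apply: ub_le_sup; [exists (f t0) => _ [u _ <-]|exists t].
Qed.

Lemma fmax_argmax f t0 : (forall t, f t <= f t0) -> fmax f = f t0.
Proof.
move=> ft0; apply/le_anti; rewrite fmax_ub andbT.
by apply: ge_sup; [exists (f t0), t0|move=> _ [t _ <-]].
Qed.

Lemma maxnorm_ub f t : `|f t| <= maxnorm f.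
Proof. exact: (fmax_ub (fun t => `|f t|)). Qed.

End simplex_mean.

Lemma cvg_sumr {R : realType} {T : finType} (u : T -> nat -> R) (l : T -> R) :
  (forall t, u t n @[n --> \oo] --> l t) ->
  (\sum_t u t n) @[n --> \oo] --> \sum_t l t.
Proof. by move=> ul; apply: cvg_big => [|t _]; [exact: add_continuous|]. Qed.

Lemma big_tuple_nil {R : realType} {X : finType} (F : seq X -> R) :
  \sum_(h : 0.-tuple X) F h = F [::].
Proof. by rewrite (big_pred1 [tuple])// => h; apply/esym/eqP; exact: tuple0. Qed.

Lemma big_tuple_cons {R : realType} {X : finType} n (F : seq X -> R) :
  \sum_(h : n.+1.-tuple X) F h = \sum_x \sum_(h : n.-tuple X) F (x :: h).
Proof.
rewrite pair_bigA/=.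
rewrite (reindex (fun p : X * n.-tuple X => [tuple of p.1 :: p.2]))//=.
exists (fun h => (thead h, [tuple of behead h])) => [[x h] _|h _]/=.
  by rewrite theadE; congr pair; exact: val_inj.
by apply: val_inj => /=; rewrite [in RHS](tuple_eta h).
Qed.

(** * The Bellman operator: monotonicity, shifts and comparison *)

Section bellman_operator.
Context {R : realType} {S A : finType} (M : mdp R S A).
Implicit Types (p : policy R S A) (V W : S -> R).
Local Notation gamma := (discount M).

Lemma ler_qbackup V W s a : (forall s, V s <= W s) ->
  qbackup M V s a <= qbackup M W s a.
Proof.
move=> VW; have /andP[g0 _] := discount_itv M.
by rewrite lerD2l ler_pM2l//; apply: ler_mean => //; exact: trans_simplex.
Qed.

Lemma qbackupD V c s a :
  qbackup M (fun s => V s + c) s a = qbackup M V s a + gamma * c.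
Proof.
by rewrite /qbackup meanD_cst ?mulrDr ?addrA//; exact: trans_simplex.
Qed.

Lemma bellmanE p V s : bellman M p V s = \sum_a p s a * qbackup M V s a.
Proof.
apply: eq_bigr => a _; congr (_ * _); rewrite /qbackup addrC mulr_sumr.
under eq_bigr do rewrite addrC.
rewrite meanD_cst; last exact: trans_simplex.
by congr (_ + _); apply: eq_bigr => s' _; rewrite mulrCA.
Qed.

Lemma ler_bellman p V W s : (forall s, V s <= W s) ->
  bellman M p V s <= bellman M p W s.
Proof.
move=> VW; rewrite !bellmanE; apply: ler_mean; first exact: policy_simplex.
by move=> a; exact: ler_qbackup.
Qed.

Lemma bellmanD p V c s :
  bellman M p (fun s => V s + c) s = bellman M p V s + gamma * c.
Proof.
rewrite !bellmanE; under eq_bigr do rewrite qbackupD.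
by rewrite meanD_cst//; exact: policy_simplex.
Qed.

Lemma bellmanB p V W s : bellman M p V s - bellman M p W s =
  gamma * \sum_a p s a * \sum_s' trans M s a s' * (V s' - W s').
Proof.
rewrite !bellmanE mulr_sumr -sumrB; apply: eq_bigr => a _.
rewrite /qbackup mulrCA -mulrBr; congr (_ * _).
rewrite opprD addrACA subrr add0r -mulrBr -sumrB; congr (_ * _).
by apply: eq_bigr => s' _; rewrite mulrBr.
Qed.

(* Evaluate at a maximiser of [W - V] and use the contraction factor [gamma]. *)
Lemma bellman_comparison p V W :
  (forall s, W s <= bellman M p W s) -> (forall s, bellman M p V s <= V s) ->
  forall s, W s <= V s.
Proof.
move=> subW superV; have [s0 s0max] := ex_argmax (W \- V) (states_ne M).
have {}s0max s : W s <= V s + (W s0 - V s0).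
  by have := s0max s; rewrite /= lerBlDl.
have := ler_bellman p s0 s0max; rewrite bellmanD.
have := subW s0; have := superV s0; have /andP[_ g1] := discount_itv M.
move=> h1 h2 h3 s; have := s0max s.
suff : W s0 - V s0 <= 0 by lra.
nra.
Qed.

(** * Finite-horizon values *)

Definition truncated_value p n : S -> R := iter n (bellman M p) (fun=> 0).

(** Rewards are at most 1, and [1 + gamma * c <= c] as soon as [c >= 1 / (1 - gamma)]. *)
Lemma bellman_cst_ge p c s : (1 - gamma)^-1 <= c -> bellman M p (fun=> c) s <= c.
Proof.
move=> hc; rewrite bellmanE; apply: mean_le; first exact: policy_simplex.
move=> a; rewrite /qbackup mean_cst; last exact: trans_simplex.
have /andP[_ r1] := reward_itv M s a; have /andP[_ g1] := discount_itv M.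
by move: hc; rewrite -div1r ler_pdivrMr ?subr_gt0//; lra.
Qed.

Lemma truncated_value_le p n s : truncated_value p n s <= (1 - gamma)^-1.
Proof.
elim: n s => [|n ih] s /=.
  by rewrite invr_ge0 subr_ge0; have /andP[_ /ltW] := discount_itv M.
by apply: le_trans (bellman_cst_ge p s (lexx _)); exact: ler_bellman.
Qed.

Lemma truncated_value_nd p n s :
  truncated_value p n s <= truncated_value p n.+1 s.
Proof.
elim: n s => [|n ih] s /=; last exact: ler_bellman.
rewrite bellmanE; apply: sumr_ge0 => a _.
rewrite mulr_ge0 ?(policy_simplex p s).1// /qbackup mean_cst; last first.
  exact: trans_simplex.
by rewrite mulr0 addr0; have /andP[] := reward_itv M s a.
Qed.

(** * Discounted returns of finite histories *)

(** The oldest step is the head, so that adding a head matches one application of the Bellman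
    operator. *)
Fixpoint history_return (h : seq (S * A)) : R :=
  if h is x :: h' then reward M x.1 x.2 + gamma * history_return h' else 0.

Lemma history_return_ge0 h : 0 <= history_return h.
Proof.
elim: h => //= x h ih; have /andP[r0 _] := reward_itv M x.1 x.2.
by have /andP[/ltW g0 _] := discount_itv M; rewrite addr_ge0// mulr_ge0.
Qed.

Lemma history_return_le h : history_return h <= (1 - gamma)^-1.
Proof.
have /andP[g0 g1] := discount_itv M; rewrite -div1r.
elim: h => [|x h]/=; first by rewrite divr_ge0// subr_ge0 ltW.
have /andP[_ r1] := reward_itv M x.1 x.2.
rewrite !ler_pdivlMr ?subr_gt0//; nra.
Qed.

Lemma history_return_mkseq (w : nat -> S * A) n :
  history_return (mkseq w n) =
  series (fun t => gamma ^+ t * reward M (w t).1 (w t).2) n.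
Proof.
rewrite /series/= /mkseq; elim: n w => [|n ih] w; first by rewrite big_nil.
rewrite big_nat_recl//= expr0 mul1r; congr (_ + _).
rewrite -[1%N]addn0 iotaDl -map_comp (ih (w \o succn)) mulr_sumr.
by apply: eq_bigr => t _; rewrite exprS mulrA.
Qed.

Lemma sum_state_action p mu (F : S -> A -> R) :
  \sum_(x : S * A) mu x.1 * p x.1 x.2 * F x.1 x.2 =
  \sum_s mu s * \sum_a p s a * F s a.
Proof.
rewrite -(pair_bigA _ (fun s a => mu s * p s a * F s a))/=.
apply: eq_bigr => s _; rewrite mulr_sumr; apply: eq_bigr => a _.
by rewrite mulrA.
Qed.

Lemma path_prob_sum1 p n mu : simplex mu ->
  \sum_(h : n.-tuple (S * A)) path_prob M p mu h = 1.
Proof.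
elim: n mu => [|n ih] mu mus; first by rewrite big_tuple_nil.
rewrite (big_tuple_cons n (path_prob M p mu)).
transitivity (\sum_x mu x.1 * p x.1 x.2 * 1).
  apply: eq_bigr => -[s a] _ /=.
  by rewrite -mulr_sumr ih//; exact: trans_simplex.
rewrite (sum_state_action p mu (fun _ _ => 1)).
rewrite -[RHS](mean_cst 1 mus); apply: eq_bigr => s _.
by rewrite mean_cst//; exact: policy_simplex.
Qed.

(** The induction needs an arbitrary initial law: the tail of a history starts afresh from
    [trans M s a]. *)
Lemma mean_history_return p n mu : simplex mu ->
  \sum_(h : n.-tuple (S * A)) path_prob M p mu h * history_return h =
  \sum_s mu s * truncated_value p n s.
Proof.
elim: n mu => [|n ih] mu mus.
  rewrite (big_tuple_nil (fun h => path_prob M p mu h * history_return h)).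
  by rewrite mean_cst// mulr0.
rewrite (big_tuple_cons n (fun h => path_prob M p mu h * history_return h)).
transitivity (\sum_x mu x.1 * p x.1 x.2 *
    qbackup M (truncated_value p n) x.1 x.2).
  apply: eq_bigr => -[s a] _ /=.
  under eq_bigr do rewrite -mulrA mulrDr.
  rewrite -mulr_sumr big_split/= -mulr_suml path_prob_sum1 ?mul1r; last first.
    exact: trans_simplex.
  congr (_ * (_ + _)); rewrite -ih; last exact: trans_simplex.
  by rewrite mulr_sumr; apply: eq_bigr => h _; rewrite mulrCA.
rewrite (sum_state_action p mu).
by apply: eq_bigr => s _; rewrite -bellmanE.
Qed.

(** * Integrals of finite returns against trajectory laws *)

Lemma measurable_cylinder h : measurable (cylinder h : set (trajectory M)).
Proof. by apply: sub_sigma_algebra; exists h. Qed.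

(** The cylinders over words of length [n] partition the trajectories, so this is a finite sum of
    indicators and its integral only involves the law of cylinders. *)
Lemma history_return_indic n :
  (fun w : trajectory M => (history_return (mkseq w n))%:E) =
  (fun w => \sum_(h : n.-tuple (S * A))
     (history_return h)%:E * (\1_(cylinder h : set (trajectory M)) w)%:E)%E.
Proof.
apply/funext => w; have szw : size (mkseq w n) == n by rewrite size_mkseq.
rewrite (bigD1 (Tuple szw))//= big1 ?adde0.
  rewrite indicE mem_set ?mule1// /cylinder/=; congr mkseq.
  by rewrite size_mkseq.
move=> h hw; rewrite indicE memNset ?mule0// /cylinder/= size_tuple => hE.
by move/eqP: hw; apply; apply: val_inj.
Qed.

Lemma measurable_indic_cylinder h : measurable_fun setT
  (fun w => (history_return h)%:E * (\1_(cylinder h : set (trajectory M)) w)%:E)%E.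
Proof.
apply: measurable_funeM; apply/measurable_EFinP.
by apply: measurable_indic; exact: measurable_cylinder.
Qed.

Lemma integral_history_return p s n :
  (\int[trajectory_law M p s]_w (history_return (mkseq w n))%:E)%E =
  (truncated_value p n s)%:E.
Proof.
have lawE : is_trajectory_law p s (trajectory_law M p s).
  exact: (projT2 (cid (trajectory_law_exists M p s))).
rewrite history_return_indic ge0_integral_sum//; last 2 first.
- by move=> h; exact: measurable_indic_cylinder.
- by move=> h w _; rewrite mule_ge0// lee_fin ?history_return_ge0.
transitivity (\sum_(h : n.-tuple (S * A))
    (path_prob M p (fun s' => (s' == s)%:R) h * history_return h)%:E)%E.
  apply: eq_bigr => h _; rewrite ge0_integralZl_EFin//; last 2 first.
  - apply/measurable_EFinP.
    by apply: measurable_indic; exact: measurable_cylinder.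
  - exact: history_return_ge0.
  rewrite integral_indic//; last exact: measurable_cylinder.
  rewrite setIT EFinM muleC; congr (_ * _)%E; exact: lawE.
rewrite sumEFin mean_history_return; last exact: simplex_dirac.
by rewrite mean_dirac.
Qed.

Lemma history_return_mkseq_nd (w : nat -> S * A) n :
  history_return (mkseq w n) <= history_return (mkseq w n.+1).
Proof.
rewrite !history_return_mkseq seriesSr lerDl.
have /andP[/ltW g0 _] := discount_itv M.
by have /andP[r0 _] := reward_itv M (w n).1 (w n).2; rewrite mulr_ge0// exprn_ge0.
Qed.

Lemma cvg_history_return (w : nat -> S * A) :
  cvgn (fun n => history_return (mkseq w n)).
Proof.
apply: nondecreasing_is_cvgn; last first.
  by exists (1 - gamma)^-1 => _ [n _ <-]; exact: history_return_le.
by apply/nondecreasing_seqP => n; exact: history_return_mkseq_nd.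
Qed.

(** * The Bellman equation of a policy *)

Lemma value_cvg p s : truncated_value p n s @[n --> \oo] --> value M p s.
Proof.
have tv_cvg : cvgn (truncated_value p ^~ s).
  apply: nondecreasing_is_cvgn; last first.
    by exists (1 - gamma)^-1 => _ [n _ <-]; exact: truncated_value_le.
  by apply/nondecreasing_seqP => n; exact: truncated_value_nd.
suff -> : value M p s = limn (truncated_value p ^~ s) by [].
rewrite /value unlock.
pose g n (w : trajectory M) := (history_return (mkseq w n))%:E.
have -> : (\int[trajectory_law M p s]_w (discounted_return w)%:E)%E =
    (\int[trajectory_law M p s]_w limn (g ^~ w))%E.
  apply: eq_integral => w _; rewrite EFin_lim; last exact: cvg_history_return.
  by congr (limn _)%:E; apply/funext => n; rewrite history_return_mkseq.
rewrite monotone_convergence//.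
- under eq_fun do rewrite integral_history_return.
  by rewrite EFin_lim.
- by move=> n; rewrite /g history_return_indic; apply: emeasurable_sum => h;
  exact: measurable_indic_cylinder.
- by move=> n w _; rewrite lee_fin history_return_ge0.
- move=> w _; apply/nondecreasing_seqP => n.
  by rewrite lee_fin history_return_mkseq_nd.
Qed.

(** The shifted sequence of truncated values tends both to the value and, by continuity of finite
    sums, to its backup. *)
Lemma value_fixpoint p s : bellman M p (value M p) s = value M p s.
Proof.
have hS : truncated_value p n.+1 s @[n --> \oo] --> value M p s.
  by rewrite (cvg_shiftS (truncated_value p ^~ s)); exact: value_cvg.
apply: (cvg_unique _ _ hS) => //=.
apply: cvg_sumr => a; apply: cvgMl_tmp; apply: cvg_sumr => s'; apply: cvgMl_tmp.
by apply: cvgD; [exact: cvg_cst|apply: cvgMl_tmp; exact: value_cvg].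
Qed.
End bellman_operator.

(** * Optimal values, greedy actions and the action gap *)

Section optimality.
Context {R : realType} {S A : finType} (M : mdp R S A).
Implicit Types (p : policy R S A) (V W : S -> R).
Local Notation gamma := (discount M).

Lemma value_ge p W : (forall s, W s <= bellman M p W s) ->
  forall s, W s <= value M p s.
Proof. by move=> /bellman_comparison; apply => s; rewrite value_fixpoint. Qed.

Lemma value_le p s : value M p s <= (1 - gamma)^-1.
Proof.
move: s; apply: (@bellman_comparison _ _ _ M p (fun=> _)) => s.
  by rewrite value_fixpoint.
exact: bellman_cst_ge.
Qed.

Lemma value_opt_ub p s : value M p s <= value_opt M s.
Proof.
by apply: ub_le_sup; [exists (1 - gamma)^-1 => _ [q _ <-]; exact: value_le|exists p].
Qed.

Lemma policy_switchP p s (a : A) s' :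
  simplex (if s' == s then fun b => (b == a)%:R else p s').
Proof. by case: ifP => _; [exact: simplex_dirac|exact: policy_simplex]. Qed.

Definition policy_switch p s a : policy R S A := Policy (policy_switchP p s a).

Variable pistar : policy R S A.
Hypothesis pistar_opt : optimal M pistar.

(** [pistar] attains the supremum at all states at once, so the supremum passes through the monotone
    backup. *)
Lemma qvalue_optE : qvalue_opt M = qbackup M (value_opt M).
Proof.
apply/funext => s; apply/funext => a; apply/le_anti/andP; split.
  apply: ge_sup; first by exists (qvalue M pistar s a), pistar.
  by move=> _ [p _ <-]; apply: ler_qbackup => s'; exact: value_opt_ub.
rewrite -pistar_opt; apply: ub_le_sup; last by exists pistar.
exists (qbackup M (value_opt M) s a) => _ [p _ <-].
by apply: ler_qbackup => s'; exact: value_opt_ub.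
Qed.

Lemma bellman_value_opt s : bellman M pistar (value_opt M) s = value_opt M s.
Proof. by rewrite -pistar_opt value_fixpoint. Qed.

(* Otherwise playing [a] at [s] and following [pistar] elsewhere would improve
   on [pistar] at [s]. *)
Lemma qvalue_opt_le s a : qvalue_opt M s a <= value_opt M s.
Proof.
rewrite leNgt; apply/negP => Qgt; pose q := policy_switch pistar s a.
have qE s' : bellman M q (value_opt M) s' =
    if s' == s then qvalue_opt M s a else value_opt M s'.
  rewrite bellmanE /=; have [->|_] := eqVneq s' s.
    by rewrite mean_dirac qvalue_optE.
  by rewrite -bellmanE bellman_value_opt.
have sub s' : value_opt M s' <= bellman M q (value_opt M) s'.
  by rewrite qE; have [->|_] := eqVneq s' s; first exact: ltW.
have : value_opt M s < value M q s.
  apply: (@lt_le_trans _ _ (bellman M q (value_opt M) s)); first by rewrite qE eqxx.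
  rewrite -(value_fixpoint M q s).
  by apply: ler_bellman => s'; exact: value_ge.
by rewrite ltNge value_opt_ub.
Qed.

(** [value_opt] is the [pistar]-mean of the optimal action values, hence at most their maximum. *)
Lemma ex_greedy s : exists a, qvalue_opt M s a = value_opt M s.
Proof.
have [a amax] := ex_argmax (qvalue_opt M s) (actions_ne M); exists a.
apply/le_anti; rewrite qvalue_opt_le/= -[leLHS]bellman_value_opt bellmanE.
by rewrite -qvalue_optE; apply: mean_le => //; exact: policy_simplex.
Qed.

Lemma fmax_qvalue_opt s : fmax (qvalue_opt M s) = value_opt M s.
Proof.
by have [a aE] := ex_greedy s; rewrite -aE; apply: fmax_argmax => b;
  rewrite aE qvalue_opt_le.
Qed.

Lemma opt_actionsE s a : opt_actions M s a <-> qvalue_opt M s a = value_opt M s.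
Proof.
split=> [aopt|aE b]; last by rewrite aE qvalue_opt_le.
by rewrite -fmax_qvalue_opt; apply/esym/fmax_argmax.
Qed.

Lemma action_gap_le s a : qvalue_opt M s a != value_opt M s ->
  action_gap M <= value_opt M s - qvalue_opt M s a.
Proof.
move=> Qneq; apply: ge_inf.
  exists 0 => _ [s' [b [_ _ ->]]].
  by rewrite fmax_qvalue_opt subr_ge0 qvalue_opt_le.
have anopt : ~ opt_actions M s a by move/opt_actionsE/eqP; exact/negP.
exists s, a; split=> //; last by rewrite fmax_qvalue_opt.
by apply/eqP => oT; apply: anopt; rewrite oT.
Qed.

Lemma action_gap_gt0 : nontrivial_states M !=set0 -> 0 < action_gap M.
Proof.
move=> [s0 /= s0nt].
(* Negated gaps, with -1 standing in for zero gaps, are all negative; minus their maximum is a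
   positive lower bound of the nonzero gaps. *)
pose f (x : S * A) : R := let d := value_opt M x.1 - qvalue_opt M x.1 x.2 in
  if d == 0 then -1 else - d.
have [|x0 x0max] := ex_argmax f.
  by rewrite card_prod muln_gt0 (states_ne M) (actions_ne M).
have fx0 : 0 < - f x0.
  rewrite /f; case: ifPn => [_|d0]; rewrite opprK ?ltr01//.
  by rewrite lt_neqAle eq_sym d0 subr_ge0 qvalue_opt_le.
apply: (lt_le_trans fx0); apply: lb_le_inf.
  have [a anopt] : exists a, ~ opt_actions M s0 a.
    apply/existsNP => all_opt; move/eqP: s0nt; apply.
    by apply/seteqP; split => // a _; exact: all_opt.
  by exists (fmax (qvalue_opt M s0) - qvalue_opt M s0 a), s0, a.
move=> _ [s [a [_ anopt ->]]]; rewrite fmax_qvalue_opt lerNl.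
apply: le_trans (x0max (s, a)); rewrite /f/= ifN// subr_eq0 eq_sym.
by apply/eqP => /opt_actionsE.
Qed.

Lemma greedy_optimal p :
  (forall s a, qvalue_opt M s a != value_opt M s -> p s a = 0) ->
  value M p = value_opt M.
Proof.
move=> psupp; apply/funext => s; apply/le_anti; rewrite value_opt_ub/=.
move: s; apply: value_ge => s; rewrite bellmanE -qvalue_optE.
rewrite -[leLHS](mean_cst _ (policy_simplex p s)); apply: ler_sum => a _.
by have [->//|/psupp ->] := eqVneq (qvalue_opt M s a) (value_opt M s);
  rewrite !mul0r.
Qed.

End optimality.

(** * Euclidean projection onto the simplex *)

Section projection.
Context {R : realType} {T : finType}.
Implicit Types (x p q u v : T -> R).

Lemma ler_l2norm u v : (l2norm u <= l2norm v) = (\sum_t u t ^+ 2 <= \sum_t v t ^+ 2).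
Proof. by rewrite ler_sqrt// sumr_ge0// => t _; rewrite sqr_ge0. Qed.

Lemma simplex_segment p q c : simplex p -> simplex q -> 0 <= c <= 1 ->
  simplex (fun t => p t + c * (q t - p t)).
Proof.
move=> [p0 p1] [q0 q1] /andP[c0 c1]; split=> [t|].
  by have := p0 t; have := q0 t; nra.
by rewrite big_split/= -mulr_sumr sumrB p1 q1 subrr mulr0 addr0.
Qed.

(** First-order optimality: were the sum positive, a suitable move from [p] towards [q] would come
    closer to [x]. *)
Lemma eproj_variational x p q : is_eproj simplex x p -> simplex q ->
  \sum_t (x t - p t) * (q t - p t) <= 0.
Proof.
move=> [ps pmin] qs; set c := \sum_t _; set n := \sum_t (q t - p t) ^+ 2.
have n0 : 0 <= n by apply: sumr_ge0 => t _; exact: sqr_ge0.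
(* Along the segment the squared distance changes by [- 2 * tau * c + tau ^+ 2 * n]. This [tau] lies
   in [0, 1] and has [tau * n <= c], so the change is at most [- tau * c < 0]. *)
rewrite leNgt; apply/negP => c0; pose tau := c / (c + n).
have cn0 : 0 < c + n by lra.
have tau01 : 0 <= tau <= 1.
  apply/andP; split; first by rewrite divr_ge0 ?ltW.
  by rewrite ler_pdivrMr// mul1r lerDl.
have := pmin _ (simplex_segment ps qs tau01); rewrite ler_l2norm/=.
have -> : \sum_t (x t - (p t + tau * (q t - p t))) ^+ 2 =
    \sum_t (x t - p t) ^+ 2 - 2 * tau * c + tau ^+ 2 * n.
  rewrite /c /n !mulr_sumr -sumrB -big_split/=.
  by apply: eq_bigr => t _; ring.
have -> : tau ^+ 2 * n = tau * (c * n / (c + n)) by rewrite /tau; field; lra.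
have tau0 : 0 < tau by rewrite divr_gt0.
suff : c * n / (c + n) <= c by nra.
by rewrite ler_pdivrMr//; nra.
Qed.

(** The variational inequality expanded by polarisation; the term dropped is half the squared
    distance from [u] to [p]. *)
Lemma eproj_three_point u v p q :
  is_eproj simplex (fun t => u t + v t) p -> simplex q ->
  \sum_t v t * q t - \sum_t v t * p t <=
  2^-1 * \sum_t (q t - u t) ^+ 2 - 2^-1 * \sum_t (q t - p t) ^+ 2.
Proof.
move=> pproj qs; rewrite -subr_le0; apply: le_trans (eproj_variational pproj qs).
rewrite !mulr_sumr -!sumrB; apply: ler_sum => t _.
by have := sqr_ge0 (p t - u t); lra.
Qed.

(* Mass can be moved from [t'] to [t] inside the simplex since [p t' > 0]. *)
Lemma eproj_transfer x p t t' : is_eproj simplex x p -> 0 < p t' ->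
  x t - p t <= x t' - p t'.
Proof.
move=> pproj pt'; have [[p0 p1] _] := pproj.
have [->//|tt'] := eqVneq t t'.
pose d i : R := (i == t)%:R - (i == t')%:R.
have qs : simplex (fun i => p i + p t' * d i).
  split=> [i|].
    rewrite /d; have [->|_] := eqVneq i t'.
      by rewrite eq_sym (negbTE tt') sub0r mulrN1 subrr.
    by rewrite subr0 addr_ge0// mulr_ge0.
  rewrite big_split/= p1 -mulr_sumr sumrB.
  by rewrite (simplex_dirac t).2 (simplex_dirac t').2 subrr mulr0 addr0.
have := eproj_variational pproj qs.
have -> : \sum_i (x i - p i) * (p i + p t' * d i - p i) =
    p t' * (\sum_i (i == t)%:R * (x i - p i) - \sum_i (i == t')%:R * (x i - p i)).
  rewrite -sumrB mulr_sumr; apply: eq_bigr => i _; rewrite /d; ring.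
by rewrite !mean_dirac pmulr_rle0// subr_le0.
Qed.

(** If some [t'] outside [O] survived, each coordinate in [O] would exceed that of [u] by at least
    the mass of [u] outside [O] plus [p t'], and [O] alone would carry mass above 1. *)
Lemma eproj_support (O : pred T) g u v p t0 :
  simplex u -> is_eproj simplex (fun t => u t + v t) p -> O t0 ->
  (forall t t', O t -> ~~ O t' -> g <= v t - v t') ->
  2 * (\sum_(t | ~~ O t) u t) <= g ->
  forall t, ~~ O t -> p t = 0.
Proof.
move=> [u0 u1] pproj Ot0 gap small t' nOt'; have [[p0 p1] _] := pproj.
apply/eqP; apply/negP => /negP pt'; have {}pt' : 0 < p t' by rewrite lt_def pt' p0.
set b := \sum_(t | _) u t in small.
have ut'b : u t' <= b by rewrite /b (bigD1 t')//= lerDl sumr_ge0.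
have b0 : 0 <= b by exact: sumr_ge0.
(* The gap is at least [2 * b]: one [b] absorbs [u t'], the other is the gain. *)
have pge t : O t -> u t + b + p t' <= p t.
  move=> Ot; have := gap t t' Ot nOt'; have := eproj_transfer t pproj pt'; lra.
have u1' : b + \sum_(t | O t) u t = 1 by rewrite -u1 [RHS](bigID O)/= addrC.
have : \sum_(t | O t) p t <= 1.
  by rewrite -p1 [leRHS](bigID O)/= lerDl sumr_ge0.
suff : \sum_(t | O t) u t + (b + p t') <= \sum_(t | O t) p t by lra.
rewrite (bigD1 t0)//= [leRHS](bigD1 t0)//= addrAC addrA lerD ?pge//.
by apply: ler_sum => t /andP[/pge]; lra.
Qed.

End projection.

Lemma bregman_distE {R : realType} {S A : finType} (p q : policy R S A) s :
  bregman_dist p q s = 2^-1 * \sum_a (p s a - q s a) ^+ 2.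
Proof.
by rewrite /bregman_dist sqr_sqrtr// sumr_ge0// => a _; exact: sqr_ge0.
Qed.

Lemma bregman_dist_ge0 {R : realType} {S A : finType} (p q : policy R S A) s :
  0 <= bregman_dist p q s.
Proof. by rewrite mulr_ge0 ?invr_ge0// sqr_ge0. Qed.

(** * TD-PQA: the shifted iterates increase *)

Section td_pqa.
Context {R : realType} {S A : finType} (M : mdp R S A).
Variables (eta : R) (V : nat -> S -> R) (pi : nat -> policy R S A).
Variable pistar : policy R S A.
Hypothesis eta_gt0 : 0 < eta.
Hypothesis td : td_pqa M eta V pi.
Hypothesis pistar_opt : optimal M pistar.
Variable kappa : R.
Local Notation gamma := (discount M).

(* Subtracting a constant from [V k] changes neither the projection steps nor,
   up to a factor [gamma] per step, the recursion, so one can make [V 0] lie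
   below its own Bellman backup. *)
Definition shifted_iterate k s : R := V k s - gamma ^+ k * kappa.
Local Notation Vs := shifted_iterate.

Hypothesis Vs0_sub : forall s, Vs 0 s <= bellman M (pi 0%N) (Vs 0) s.

Lemma shifted_iterateS k s : Vs k.+1 s = bellman M (pi k.+1) (Vs k) s.
Proof. by rewrite /Vs bellmanD (td k s).2 exprS; ring. Qed.

(** The constant separating [V k] from [Vs k] cancels, because [q] and [pi k.+1 s] both have total
    mass 1. *)
Lemma shifted_three_point k s (q : A -> R) : simplex q ->
  eta * (\sum_a q a * qbackup M (Vs k) s a - Vs k.+1 s) <=
  2^-1 * \sum_a (q a - pi k s a) ^+ 2 - 2^-1 * \sum_a (q a - pi k.+1 s a) ^+ 2.
Proof.
move=> qs; apply: le_trans (eproj_three_point (td k s).1 qs).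
rewrite le_eqVlt; apply/orP; left; apply/eqP.
rewrite shifted_iterateS bellmanE.
under eq_bigr do rewrite qbackupD.
under [X in _ - X]eq_bigr do rewrite qbackupD.
rewrite !meanD_cst//; last exact: policy_simplex.
rewrite opprD addrACA subrr addr0 mulrBr !mulr_sumr.
by congr (_ - _); apply: eq_bigr => a _; ring.
Qed.

(** Policy improvement: for [q := pi k s] the first squared distance vanishes. *)
Lemma bellman_shifted_le k s : bellman M (pi k) (Vs k) s <= Vs k.+1 s.
Proof.
have := shifted_three_point k s (policy_simplex (pi k) s).
rewrite -bellmanE [X in 2^-1 * X - _]big1 => [|a _]; last first.
  by rewrite subrr expr0n.
have : 0 <= \sum_a (pi k s a - pi k.+1 s a) ^+ 2.
  by apply: sumr_ge0 => a _; exact: sqr_ge0.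
move=> d0 h; rewrite -subr_le0 -(pmulr_rle0 _ eta_gt0); lra.
Qed.

(** The property at [k] makes the iterate increase from [k] to [k.+1], and the operator of [pi k.+1]
    is monotone. *)
Lemma shifted_iterate_sub k s : Vs k s <= bellman M (pi k) (Vs k) s.
Proof.
elim: k s => [//|k ih] s; rewrite {1}shifted_iterateS.
apply: ler_bellman => s'; apply: le_trans (ih s') _.
exact: bellman_shifted_le.
Qed.

Lemma shifted_iterate_nd k s : Vs k s <= Vs k.+1 s.
Proof. exact: le_trans (shifted_iterate_sub k s) (bellman_shifted_le k s). Qed.

(** * Decay of the gap to the optimal value *)

Definition optimality_gap k s : R := value_opt M s - Vs k s.
Local Notation gap := optimality_gap.

Lemma optimality_gap_ni m n s : (m <= n)%N -> gap n s <= gap m s.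
Proof.
move=> mn; rewrite lerD2l lerN2.
by apply: (homo_leq (f := Vs ^~ s) le_refl le_trans _ mn) => k;
  exact: shifted_iterate_nd.
Qed.

(** Take [q := pistar s] and write [value_opt] as its own [pistar]-backup. *)
Lemma optimality_gapS k s :
  gap k.+1 s + bregman_dist pistar (pi k.+1) s / eta <=
  gamma * (\sum_a pistar s a * \sum_s' trans M s a s' * gap k s') +
  bregman_dist pistar (pi k) s / eta.
Proof.
rewrite -bellmanB bellman_value_opt// bellmanE.
have := shifted_three_point k s (policy_simplex pistar s).
rewrite -!bregman_distE mulrC -ler_pdivlMr// mulrBl /gap; lra.
Qed.

(** The distances telescope. The sum on the right is one term shorter, which allows the induction of
    the next bound. *)
Lemma sum_optimality_gapS n s :
  \sum_(k < n.+1) gap k s + bregman_dist pistar (pi n) s / eta <=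
  gap 0 s + bregman_dist pistar (pi 0%N) s / eta +
  gamma * \sum_a pistar s a * \sum_s' trans M s a s' * \sum_(k < n) gap k s'.
Proof.
elim: n => [|n ih].
  rewrite big_ord_recr big_ord0/= add0r lerDl.
  rewrite [X in gamma * X]big1 ?mulr0// => a _.
  by rewrite big1 ?mulr0// => s' _; rewrite big_ord0 mulr0.
have -> : \sum_a pistar s a * \sum_s' trans M s a s' * \sum_(k < n.+1) gap k s' =
    \sum_a pistar s a * \sum_s' trans M s a s' * \sum_(k < n) gap k s' +
    \sum_a pistar s a * \sum_s' trans M s a s' * gap n s'.
  rewrite -big_split/=; apply: eq_bigr => a _; rewrite -mulrDr -big_split/=.
  by congr (_ * _); apply: eq_bigr => s' _; rewrite big_ord_recr mulrDr.
rewrite big_ord_recr/=; have := optimality_gapS n s.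
move: ih; rewrite mulrDr; lra.
Qed.

(** An average of sums bounded by [C] is bounded by [C], and [(1 - gamma) * C + gamma * C = C]
    closes the induction. *)
Lemma sum_optimality_gap_le C n s : 0 <= C ->
  (forall s, gap 0 s + bregman_dist pistar (pi 0%N) s / eta <= (1 - gamma) * C) ->
  \sum_(k < n) gap k s <= C.
Proof.
move=> C0 hC; elim: n s => [|n ih] s; first by rewrite big_ord0.
have := sum_optimality_gapS n s; have := hC s.
have : 0 <= bregman_dist pistar (pi n) s / eta.
  by rewrite divr_ge0 ?bregman_dist_ge0// ltW.
have : \sum_a pistar s a * \sum_s' trans M s a s' * \sum_(k < n) gap k s' <= C.
  apply: mean_le => [|a]; first exact: policy_simplex.
  by apply: mean_le => //; exact: trans_simplex.
have /andP[g0 _] := discount_itv M; nra.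
Qed.

Lemma optimality_gap_le C n s : 0 <= C ->
  (forall s, gap 0 s + bregman_dist pistar (pi 0%N) s / eta <= (1 - gamma) * C) ->
  n.+1%:R * gap n s <= C.
Proof.
move=> C0 hC; apply: le_trans (sum_optimality_gap_le n.+1 s C0 hC).
rewrite mulr_natl -[X in _ *+ X]card_ord -sumr_const; apply: ler_sum => k _.
by apply: optimality_gap_ni; rewrite -ltnS.
Qed.

(** * From a small gap to an optimal policy *)

(** The [pi k]-mean of [value_opt - qvalue_opt] dominates the left-hand side. It equals [value_opt]
    minus its [pi k]-backup, and that backup dominates [Vs k]. *)
Lemma suboptimal_mass_le k s :
  action_gap M * (\sum_(a | qvalue_opt M s a != value_opt M s) pi k s a) <= gap k s.
Proof.
apply: (@le_trans _ _ (\sum_a pi k s a * (value_opt M s - qvalue_opt M s a))).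
  rewrite mulr_sumr [leRHS](bigID (fun a => qvalue_opt M s a != value_opt M s))/=.
  rewrite -[leLHS]addr0 lerD//.
    apply: ler_sum => a Qneq; rewrite mulrC ler_wpM2l//.
      by rewrite (policy_simplex (pi k) s).1.
    exact: (action_gap_le pistar_opt).
  apply: sumr_ge0 => a _; rewrite mulr_ge0 ?(policy_simplex (pi k) s).1//.
  by rewrite subr_ge0 (qvalue_opt_le pistar_opt).
under eq_bigr do rewrite mulrBr.
rewrite sumrB (mean_cst _ (policy_simplex (pi k) s)) (qvalue_optE pistar_opt).
rewrite -bellmanE lerD2l lerN2; apply: le_trans (shifted_iterate_sub k s) _.
apply: ler_bellman => s'.
apply: le_trans (value_opt_ub M (pi k) s'); apply: value_ge.
exact: shifted_iterate_sub.
Qed.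

(** The bound [x] acts twice: the suboptimal mass of [pi k] is at most [x / action_gap M], and the
    projection step separates optimal from other actions by at least
    [eta * (action_gap M - gamma * x)]. *)
Lemma iterate_optimal k x : 0 < action_gap M ->
  (forall s, gap k s <= x) ->
  2 * (x / action_gap M) <= eta * (action_gap M - gamma * x) ->
  value M (pi k.+1) = value_opt M.
Proof.
move=> D0 gapx hx; apply: (greedy_optimal pistar_opt) => s a.
have [a0 a0E] := ex_greedy pistar_opt s.
apply: (eproj_support (O := fun b => qvalue_opt M s b == value_opt M s)
  (policy_simplex (pi k) s) (td k s).1 (g := eta * (action_gap M - gamma * x))
  (t0 := a0)); first exact/eqP.
- move=> b b' /eqP bE /(action_gap_le pistar_opt) gapb'.
  rewrite -mulrBr ler_pM2l//.
  have QkE c : qbackup M (V k) s c =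
      qbackup M (Vs k) s c + gamma * (gamma ^+ k * kappa).
    rewrite -qbackupD; congr qbackup; apply/funext => s'.
    by rewrite /Vs subrK.
  rewrite !QkE.
  have : qvalue_opt M s b - gamma * x <= qbackup M (Vs k) s b.
    rewrite (qvalue_optE pistar_opt) -mulrN -qbackupD; apply: ler_qbackup => s'.
    by have := gapx s'; rewrite /gap; lra.
  have : qbackup M (Vs k) s b' <= qvalue_opt M s b'.
    rewrite (qvalue_optE pistar_opt); apply: ler_qbackup => s'.
    apply: le_trans (value_opt_ub M (pi k) s'); apply: value_ge.
    exact: shifted_iterate_sub.
  rewrite bE; lra.
- apply: le_trans hx; rewrite ler_pM2l// ler_pdivlMr// mulrC.
  exact: le_trans (suboptimal_mass_le k s) (gapx s).
Qed.

End td_pqa.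

(** * The explicit threshold *)

Theorem theorem3p10 (R : realType) (S A : finType) (M : mdp R S A) (eta : R)
    (V : nat -> S -> R) (pi : nat -> policy R S A) (pistar : policy R S A) :
  nontrivial_states M !=set0 ->
  0 < eta ->
  td_pqa M eta V pi ->
  deterministic pistar ->
  optimal M pistar ->
  let gamma := discount M in
  let Delta := action_gap M in
  let eps := eta * gamma * Delta ^+ 2 / (2 * eta * gamma * Delta + 2) in
  let kappa0 := Num.max 0
    ((1 - gamma)^-1 * fmax (fun s => V 0%N s - bellman M (pi 0%N) (V 0%N) s)) in
  let B := 2 * gamma / eps *
    (1 / (1 - gamma) ^+ 2
     + (maxnorm (V 0%N) + kappa0) / (1 - gamma)
     + maxnorm (bregman_dist pistar (pi 0%N)) / (eta * (1 - gamma))) in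
  let T0 : int :=
    if 0 < kappa0 then
      Num.ceil (Num.max B
        ((ln eps - ln (2 * gamma) - ln kappa0) / ln gamma))
    else Num.ceil B in
  forall k : nat, T0 <= k%:Z ->
    qvalue M (pi k) = qvalue_opt M /\ value M (pi k) = value_opt M.
Proof.
move=> nt eta0 td _ pistar_opt gamma Delta eps kappa0 B T0 k T0k.
suff Vk : value M (pi k) = value_opt M.
  by rewrite /qvalue Vk (qvalue_optE pistar_opt).
have /andP[g0 g1] : 0 < gamma < 1 := discount_itv M.
have D0 : 0 < Delta := action_gap_gt0 pistar_opt nt.
have g1' : 0 < 1 - gamma by rewrite subr_gt0.
have y0 : 0 < eta * gamma * Delta by rewrite !mulr_gt0.
have eps0 : 0 < eps by rewrite divr_gt0 ?mulr_gt0 ?exprn_gt0//; lra.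
have x0 : 0 < eps / (2 * gamma) by rewrite divr_gt0// mulr_gt0.
have Bk : B <= k%:R.
  move: T0k; rewrite /T0; case: ifP => _; rewrite ceil_le_int//.
  by rewrite ge_max => /andP[].
have kappa0_ge0 : 0 <= kappa0 by rewrite le_max lexx.
have [s0 _] : exists s0 : S, true by have /card_gt0P[s0 _] := states_ne M; exists s0.
have norm_ge0 (f : S -> R) : 0 <= maxnorm f by apply: le_trans (maxnorm_ub f s0).
(* The bracket in [B], so that [B = 2 * gamma / eps * C]. *)
pose C := 1 / (1 - gamma) ^+ 2 + (maxnorm (V 0%N) + kappa0) / (1 - gamma)
  + maxnorm (bregman_dist pistar (pi 0%N)) / (eta * (1 - gamma)).
have C0 : 0 < C.
  apply: ltr_wpDr; first by apply: divr_ge0 => //; apply: mulr_ge0; exact: ltW.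
  apply: ltr_wpDr; first by apply: divr_ge0; [exact: addr_ge0|exact: ltW].
  by rewrite div1r invr_gt0 exprn_gt0.
have CE : (1 - gamma) * C = (1 - gamma)^-1 + (maxnorm (V 0%N) + kappa0)
    + maxnorm (bregman_dist pistar (pi 0%N)) / eta.
  by rewrite /C; field; rewrite !gt_eqF.
(* With the shift moved across, this is [V 0 - bellman (V 0) <= (1 - gamma) * kappa0], which the
   choice of [kappa0] ensures. *)
have sub0 s : shifted_iterate M V kappa0 0 s <=
    bellman M (pi 0%N) (shifted_iterate M V kappa0 0) s.
  rewrite /shifted_iterate bellmanD expr0 mul1r.
  have : (1 - gamma)^-1 * (V 0%N s - bellman M (pi 0%N) (V 0%N) s) <= kappa0.
    rewrite le_max; apply/orP; right; rewrite ler_pM2l ?invr_gt0//.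
    exact: (fmax_ub (fun s => V 0%N s - bellman M (pi 0%N) (V 0%N) s)).
  by rewrite mulrC ler_pdivrMr// -/gamma; lra.
have gap0 s : optimality_gap M V kappa0 0 s + bregman_dist pistar (pi 0%N) s / eta
    <= (1 - gamma) * C.
  rewrite CE; apply: lerD; last first.
    rewrite ler_pM2r ?invr_gt0//; apply: le_trans (maxnorm_ub _ s).
    exact: ler_norm.
  rewrite /optimality_gap /shifted_iterate expr0 mul1r opprB addrA addrAC.
  rewrite -addrA addrC.
  have := value_le M pistar s; rewrite pistar_opt -/gamma.
  by have := maxnorm_ub (V 0%N) s; have := ler_norm (- V 0%N s); rewrite normrN; lra.
(* A projection step must precede [pi k]; [k = 0] is excluded by [B > 0]. *)
case: k {T0k} Bk => [|k] Bk.
  suff: 0 < B by rewrite ltNge Bk.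
  by rewrite /B -/C -invf_div mulr_gt0// invr_gt0.
apply: (iterate_optimal eta0 td pistar_opt sub0 (x := eps / (2 * gamma)) D0).
  (* Since [B <= k.+1], the gap is at most [C / k.+1 <= eps / (2 * gamma)]. *)
  move=> s; have := optimality_gap_le eta0 td pistar_opt sub0 k s (ltW C0) gap0.
  rewrite -ler_pdivlMl ?ltr0n// => /le_trans; apply.
  rewrite ler_pdivrMl ?ltr0n// mulrC -ler_pdivrMl//.
  by apply: le_trans Bk; rewrite /B -/C invf_div.
(* With [y = eta * gamma * Delta], dividing by [eta * Delta] reduces the condition to
   [2 + y <= 4 * (y + 1)]. *)
have -> : eps / (2 * gamma) = eta * Delta ^+ 2 / (4 * (eta * gamma * Delta + 1)).
  by rewrite /eps; field; rewrite !gt_eqF//; lra.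
rewrite -[action_gap M]/Delta -[discount M]/gamma.
set y := eta * gamma * Delta in y0 *.
have -> : 2 * (eta * Delta ^+ 2 / (4 * (y + 1)) / Delta) = eta * Delta * (2 / (4 * (y + 1))).
  by field; rewrite !gt_eqF//; lra.
have -> : eta * (Delta - gamma * (eta * Delta ^+ 2 / (4 * (y + 1)))) =
    eta * Delta * (1 - y / (4 * (y + 1))).
  by rewrite /y; field; rewrite gt_eqF//; rewrite -/y; lra.
rewrite ler_pM2l ?mulr_gt0// lerBrDr -mulrDl ler_pdivrMr; lra.
Qed.
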